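(* Let $\mathcal{H}=(X,\mathcal{F})$ be a finite hypergraph. If Maker has a winning strategy in the stotting Maker-Breaker game on $\mathcal{H}$, then Waiter has a winning strategy in the (classical) Waiter-Client game on $\mathcal{H}$.
   Context: A hypergraph $\mathcal{H}=(X,\mathcal{F})$ consists of a set $X$ (the board) and a set $\mathcal{F}\subseteq 2^X$ (the winning sets). Maker-Breaker game on $\mathcal{H}$: two players, Maker and Breaker, claim previously unclaimed elements of $X$ in turns until all elements are claimed; in each turn Breaker first claims one element and then Maker claims one element (if one is left). Maker wins if at the end Maker has claimed all elements of some $F\in\mathcal{F}$; otherwise Breaker wins. Stotting Maker-Breaker game on $\mathcal{H}$: defined like the Maker-Breaker game, except that before each turn (which consists of two moves, one by each player, each move claiming one unclaimed element) Breaker decides which of the two players moves first in that turn. (If only one unclaimed element remains, the player chosen to go first claims it and the game ends.) The winning condition is unchanged. Waiter-Client game on $\mathcal{H}$: in each turn, Waiter offers two unclaimed elements of $X$ to Client; Client takes one of them and Waiter receives the other. If at the end only one unclaimed element remains, it goes to Client. Waiter wins if at the end Waiter has received all elements of some $F\in\mathcal{F}$; otherwise Client wins. *)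

(* Defs.v *)
From mathcomp Require Import all_boot.

Set Implicit Arguments.
Unset Strict Implicit.
Unset Printing Implicit Defensive.

(* A finite hypergraph is given by its board [X : finType] and its winning sets
   [F : {set {set X}}].

   In both games a strategy is a function of the whole history of the game, and
   histories are listed with the most recent event first.  Strategies have
   values in an option type because the board may be empty; a winning strategy
   is required to give a legal move wherever its owner has to move. *)

Inductive player := Maker | Breaker.

Definition is_Maker (p : player) : bool :=
  if p is Maker then true else false.

Section StottingMakerBreaker.

Variables (X : finType) (F : {set {set X}}).

Definition claim : Type := player * X.

Implicit Types (h : seq claim) (s : seq claim -> option X).

Definition unclaimed h : {set X} := [set x | x \notin [seq c.2 | c <- h]].

Definition Maker_set h : {set X} :=
  [set x in [seq c.2 | c <- h & is_Maker c.1]].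

(* The claims number 2k and 2k+1 form a turn.  When a turn starts either player
   may be the next to move, the choice being Breaker's; in the middle of a turn
   it is the player who did not make the first claim of that turn. *)
Definition may_move h (p : player) : Prop :=
  if h is c :: _ then odd (size h) -> p <> c.1 else True.

(* The histories that can arise when Maker uses [s]: Breaker's choices of who
   starts each turn and of his own claims are arbitrary. *)
Inductive stotting_play s : seq claim -> Prop :=
| stotting_start : stotting_play s [::]
| stotting_Breaker h x :
    stotting_play s h -> may_move h Breaker ->
    x \in unclaimed h -> stotting_play s ((Breaker, x) :: h)
| stotting_Maker h x :
    stotting_play s h -> may_move h Maker ->
    x \in unclaimed h -> s h = Some x -> stotting_play s ((Maker, x) :: h).

Definition Maker_strategy_legal s : Prop :=
  forall h, stotting_play s h -> may_move h Maker -> unclaimed h != set0 ->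
  exists2 x, s h = Some x & x \in unclaimed h.

Definition Maker_strategy_wins s : Prop :=
  forall h, stotting_play s h -> unclaimed h = set0 ->
  exists2 A, A \in F & A \subset Maker_set h.

Definition Maker_wins_stotting : Prop :=
  exists s, Maker_strategy_legal s /\ Maker_strategy_wins s.

End StottingMakerBreaker.

Section WaiterClient.

Variables (X : finType) (F : {set {set X}}).

(* The turn [(w, c)] is the one in which [w] and [c] were offered, Waiter
   received [w] and Client took [c]. *)
Definition wc_turn : Type := X * X.

Implicit Types (h : seq wc_turn) (s : seq wc_turn -> option (X * X)).

Definition Waiter_set h : {set X} := [set x in [seq t.1 | t <- h]].

Definition Client_set h : {set X} := [set x in [seq t.2 | t <- h]].

Definition wc_unclaimed h : {set X} := ~: (Waiter_set h :|: Client_set h).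

Definition legal_offer h (o : X * X) : Prop :=
  [/\ o.1 \in wc_unclaimed h, o.2 \in wc_unclaimed h & o.1 != o.2].

(* The histories that can arise when Waiter uses [s], whatever Client does; the
   order inside an offered pair is irrelevant. *)
Inductive wc_play s : seq wc_turn -> Prop :=
| wc_start : wc_play s [::]
| wc_Client_takes_snd h a b :
    wc_play s h -> s h = Some (a, b) -> legal_offer h (a, b) ->
    wc_play s ((a, b) :: h)
| wc_Client_takes_fst h a b :
    wc_play s h -> s h = Some (a, b) -> legal_offer h (a, b) ->
    wc_play s ((b, a) :: h).

Definition Waiter_strategy_legal s : Prop :=
  forall h, wc_play s h -> 1 < #|wc_unclaimed h| ->
  exists2 o, s h = Some o & legal_offer h o.

(* No pair can be offered once at most one element is unclaimed; a last element
   goes to Client, hence does not change [Waiter_set]. *)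
Definition Waiter_strategy_wins s : Prop :=
  forall h, wc_play s h -> #|wc_unclaimed h| <= 1 ->
  exists2 A, A \in F & A \subset Waiter_set h.

Definition Waiter_wins_Waiter_Client : Prop :=
  exists s, Waiter_strategy_legal s /\ Waiter_strategy_wins s.

End WaiterClient.

(* Main.v *)
Require Import Defs.
From mathcomp Require Import all_boot.

Set Implicit Arguments.
Unset Strict Implicit.
Unset Printing Implicit Defensive.

(** Waiter plays the stotting game in her head, in the role of Maker and with a
    winning strategy [s], keeping the two positions equal: her elements are
    Maker's, Client's are Breaker's.  At the start of a turn, let [a] be the
    element that [s] claims when Maker is told to go first, and [b] the answer
    of [s] when Breaker goes first and claims [a].  Waiter offers [a] and [b].
    - If Client takes [b], the outcome is that of the turn in which Breaker let
      Maker go first, Maker claimed [a] and Breaker answered with [b].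
    - If Client takes [a], it is that of the turn in which Breaker went first
      and claimed [a], and Maker answered with [b].
    Either way the new position is again reached by a play consistent with [s]
    (lemma [stotting_play_simulation]).  A last single element goes to Client,
    which is what happens in the stotting game when Breaker decides to go first,
    so Waiter ends with the elements that Maker has in a finished play. *)

Section Simulation.

Variables (X : finType) (s : seq (claim X) -> option X).

Implicit Types (g : seq (claim X)) (h : seq (wc_turn X)).

(** Whether Maker or Breaker went first in the imagined turn is read off from
    Waiter's element: Maker did exactly when it is the element that [s] claims
    as first player. *)
Fixpoint simulation h : seq (claim X) :=
  if h is (w, c) :: h' then
    let g := simulation h' in
    if s g == Some w then [:: (Breaker, c), (Maker, w) & g]
    else [:: (Maker, w), (Breaker, c) & g]
  else [::].

Definition offer h : option (X * X) :=
  let g := simulation h in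
  if s g is Some a then
    if s ((Breaker, a) :: g) is Some b then Some (a, b) else None
  else None.

Lemma offerP h a b :
  offer h = Some (a, b) ->
  s (simulation h) = Some a /\ s ((Breaker, a) :: simulation h) = Some b.
Proof.
rewrite /offer; case sa: (s _) => [a'|] //.
by case sb: (s _) => [b'|] // [<- <-].
Qed.

Lemma unclaimed_cons g p x y :
  (y \in unclaimed ((p, x) :: g)) = (y != x) && (y \in unclaimed g).
Proof. by rewrite !inE /= negb_or. Qed.

Lemma Maker_set_Breaker g x : Maker_set ((Breaker, x) :: g) = Maker_set g.
Proof. by []. Qed.

Lemma odd_size_simulation h : odd (size (simulation h)) = false.
Proof. by elim: h => [|[w c] h IH] //=; case: ifP => _ /=; rewrite IH. Qed.

Lemma may_move_simulation h p : may_move (simulation h) p.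
Proof.
by move: (odd_size_simulation h); rewrite /may_move; case: (simulation h) => // c g ->.
Qed.

Lemma unclaimed_simulation h : unclaimed (simulation h) = wc_unclaimed h.
Proof.
apply/setP => x; elim: h => [|[w c] h IH]; first by rewrite !inE.
have -> : (x \in unclaimed (simulation ((w, c) :: h))) =
          [&& x != w, x != c & x \in unclaimed (simulation h)].
  by rewrite /=; case: ifP => _; rewrite !unclaimed_cons // andbCA.
rewrite IH !inE /= !negb_or.
by case: (x == w); case: (x == c); rewrite ?andbF.
Qed.

Lemma Maker_set_simulation h : Maker_set (simulation h) = Waiter_set h.
Proof.
apply/setP => x; elim: h => [|[w c] h IH]; first by rewrite !inE.
move: IH; rewrite !inE /= => IH.
by case: ifP => _ /=; rewrite !inE IH.
Qed.

(** The two answers of Client to the offer of [a] and [b] correspond to the two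
    decisions of Breaker about who goes first. *)
Lemma stotting_play_simulation h :
  wc_play offer h -> stotting_play s (simulation h).
Proof.
elim=> {h} [|h a b _ play_g /offerP[sa sb] [/= aU bU a_b]
            |h a b _ play_g /offerP[sa sb] [/= aU bU a_b]] /=;
  first exact: stotting_start.
all: rewrite -unclaimed_simulation in aU bU.
- rewrite sa eqxx; apply: stotting_Breaker.
  + by apply: stotting_Maker => //; apply: may_move_simulation.
  + by [].
  + by rewrite unclaimed_cons eq_sym a_b.
- have -> : (s (simulation h) == Some b) = false.
    by rewrite sa; apply: contra_neqF a_b => /eqP[].
  apply: stotting_Maker => //.
  + by apply: stotting_Breaker => //; apply: may_move_simulation.
  + by rewrite unclaimed_cons eq_sym a_b.
Qed.

Lemma offer_legal : Maker_strategy_legal s -> Waiter_strategy_legal offer.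
Proof.
move=> legal_s h play_h; rewrite -unclaimed_simulation => U_gt1.
have play_g := stotting_play_simulation play_h.
have U_neq0 : unclaimed (simulation h) != set0 by rewrite -card_gt0 ltnW.
have [a sa aU] := legal_s _ play_g (may_move_simulation h Maker) U_neq0.
have play_ga : stotting_play s ((Breaker, a) :: simulation h).
  by apply: stotting_Breaker => //; apply: may_move_simulation.
have Ua_neq0 : unclaimed ((Breaker, a) :: simulation h) != set0.
  have -> : unclaimed ((Breaker, a) :: simulation h)
            = unclaimed (simulation h) :\ a.
    by apply/setP => y; rewrite unclaimed_cons in_setD1.
  by move: U_gt1; rewrite (cardsD1 a) aU -card_gt0.
have [//|b sb] := legal_s _ play_ga _ Ua_neq0.
rewrite unclaimed_cons => /andP[b_a bU].
exists (a, b); first by rewrite /offer sa sb.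
by split; rewrite -?unclaimed_simulation //= eq_sym.
Qed.

Lemma offer_wins (F : {set {set X}}) :
  Maker_strategy_wins F s -> Waiter_strategy_wins F offer.
Proof.
move=> wins_s h play_h; rewrite -unclaimed_simulation -Maker_set_simulation.
have play_g := stotting_play_simulation play_h.
rewrite leq_eqVlt ltnS leqn0 cards_eq0 => /orP[/cards1P[x Ux]|/eqP U0];
  last exact: wins_s.
(* Breaker lets himself go first and claims the last element. *)
rewrite -(Maker_set_Breaker _ x); apply: wins_s.
  by apply: stotting_Breaker; rewrite ?Ux ?set11 //; apply: may_move_simulation.
by apply/setP => y; rewrite unclaimed_cons Ux !inE andNb.
Qed.

End Simulation.

Theorem proposition1p1 (X : finType) (F : {set {set X}}) :
  Maker_wins_stotting F -> Waiter_wins_Waiter_Client F.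
Proof.
move=> [s [legal_s wins_s]]; exists (offer s).
by split; [apply: offer_legal | apply: offer_wins].
Qed.
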